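(* Let $(X,d,\bar x)$ be a pointed separable metric space, let $\{x_n:n\in\mathbb{N}\}$ (with $\mathbb{N}=\{0,1,2,\dots\}$) be a countable dense subset of $X$ with $x_0=\bar x$, and let $M_n=\{x_0,x_1,\dots,x_n\}$ for all $n\in\mathbb{N}$. Let $K\ge1$. Then the following properties are equivalent: (a) $\mathcal{F}(X)$ has the $K$-bounded approximation property; (b) $X$ admits an asymptotic $K$-random projection on $(M_n)_n$; i.e., for every $n\in\mathbb{N}$ there exists a family $\{\upsilon_x^n:x\in X\}\subseteq\mathcal{F}(M_n)$ such that: (i) $\lim_n W_1(\upsilon_x^n,\delta_x)=0$ for every $x\in\bigcup_n M_n$; (ii) $W_1(\upsilon_x^n,\upsilon_y^n)\le K\,d(x,y)$ for every $x,y\in X$ and $n\in\mathbb{N}$.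
   Context: $\mathrm{Lip}_0(X)$ is the Banach space of real-valued Lipschitz functions on $X$ vanishing at $\bar x$, normed by the Lipschitz constant. The free (Arens-Eells) space $\mathcal{F}(X)$ is the norm closure of $\mathrm{span}\{\delta_x:x\in X\}$ in $\mathrm{Lip}_0(X)^*$, where $\delta_x(f)=f(x)$. Each $\mathcal{F}(M_n)$ (base point $\bar x$) is regarded as a closed subspace of $\mathcal{F}(X)$ via the canonical isometric embedding $\mu\mapsto(f\mapsto\mu(f|_{M_n}))$. For $\mu,\eta\in\mathcal{F}(X)$, $W_1(\mu,\eta)=\|\mu-\eta\|_{\mathcal{F}(X)}$. For $1\le\lambda<\infty$, a Banach space $Y$ has the $\lambda$-bounded approximation property ($\lambda$-BAP) if for every $\varepsilon>0$ and every compact set $C\subseteq Y$ there is a bounded finite-rank linear operator $T:Y\to Y$ with $\|T\|\le\lambda$ and $\|T(y)-y\|\le\varepsilon$ for all $y\in C$. *)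

(* Defs.v *)
From HB Require Import structures.
From mathcomp Require Import all_boot all_order all_algebra.
From mathcomp Require Import all_classical all_reals.
From mathcomp Require Import topology normedtype.

Set Implicit Arguments.
Unset Strict Implicit.
Unset Printing Implicit Defensive.

Import Order.TTheory GRing.Theory Num.Theory.
Import numFieldNormedType.Exports.

Local Open Scope classical_set_scope.
Local Open Scope ring_scope.

Section subspace_metric.
Context {R : realType} {X : metricType R} (A : set X).

Let sub_mdist (x y : A) : R := mdist (set_val x) (set_val y).

Let sub_mdist_ge0 x y : 0 <= sub_mdist x y.
Proof. exact: mdist_ge0. Qed.

Let sub_mdist_positivity x y : sub_mdist x y = 0 -> x = y.
Proof. by move=> /mdist_positivity; exact: val_inj. Qed.

Let ballE_sub_mdist (x : A) d : ball x d = [set y | sub_mdist x y < d].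
Proof.
by rewrite -(@initial_ballE _ (A : Type) X set_val) ballEmdist.
Qed.

HB.instance Definition _ := @PseudoMetric_isMetric.Build R (set_type A)
  sub_mdist sub_mdist_ge0 sub_mdist_positivity ballE_sub_mdist.

End subspace_metric.

Section linear_span.
Context {R : realType} {V : lmodType R}.
Implicit Types A : set V.

Definition lspan A : set V :=
  [set v | exists2 s : seq (R * V), (forall p, p \in s -> A p.2) &
             v = \sum_(p <- s) p.1 *: p.2].

Lemma lspan0 A : lspan A 0.
Proof. by exists [::]; rewrite ?big_nil. Qed.

Lemma lspanP A (a : R) u v : lspan A u -> lspan A v -> lspan A (a *: u + v).
Proof.
move=> [s sA ->] [t tA ->].
exists ([seq (a * p.1, p.2) | p <- s] ++ t).
  move=> p; rewrite mem_cat => /orP[/mapP[q qs ->]|]; [exact: sA _ qs|exact: tA].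
rewrite big_cat/= big_map scaler_sumr; congr (_ + _).
by apply: eq_bigr => p _; rewrite scalerA.
Qed.

End linear_span.

Section closure_submodule.
Context {R : realType} {V : normedModType R}.
Implicit Types A : set V.

Lemma closure_normP A v :
  closure A v <-> forall e : R, 0 < e -> exists2 a, A a & `|v - a| < e.
Proof.
split=> [cAv e e0|H B].
  have [a [Aa vea]] := cAv _ (nbhsx_ballx v e e0).
  by exists a => //; move: vea; rewrite -ball_normE.
rewrite -nbhs_ballE => -[e /= e0 eB]; have [a Aa ae] := H _ e0.
by exists a; split => //; apply: eB; rewrite -ball_normE.
Qed.

Lemma closure_submod A : A 0 ->
  (forall (a : R) u v, A u -> A v -> A (a *: u + v)) ->
  forall (a : R) u v, closure A u -> closure A v -> closure A (a *: u + v).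
Proof.
move=> A0 AP a u v /closure_normP Au /closure_normP Av.
apply/closure_normP => e e0.
have a0 : 0 < `|a| + 1 by rewrite ltr_wpDl.
have [u' Au' uu'] := Au (e / 2 / (`|a| + 1)) ltac:(by rewrite !divr_gt0).
have [v' Av' vv'] := Av (e / 2) ltac:(by rewrite divr_gt0).
exists (a *: u' + v'); first exact: AP.
rewrite opprD addrACA -scalerBr (le_lt_trans (ler_normD _ _))//.
rewrite [e in ltRHS]splitr ler_ltD// normrZ.
rewrite (le_trans (ler_wpM2l (normr_ge0 a) (ltW uu')))//.
rewrite mulrCA; apply: ler_piMr; first by rewrite ltW// divr_gt0.
by rewrite ltW// ltr_pdivrMr// mul1r ltrDl.
Qed.

End closure_submodule.

Section operator_norm.
Context {R : realType}.
Implicit Types V W : normedModType R.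

Definition bounded_operator V W (f : V -> W) : Prop :=
  exists M : R, forall v, `|f v| <= M * `|v|.

(* As the supremum of an unbounded set is 0, this is meaningful only for
   operators satisfying bounded_operator. *)
Definition opnorm V W (f : V -> W) : R :=
  sup [set `|f v| | v in [set v | `|v| <= 1]].

Definition finite_rank V W (f : V -> W) : Prop :=
  exists2 S : set W, finite_set S & range f = lspan S.

Lemma opnorm_has_sup V W (f : V -> W) : bounded_operator f ->
  has_sup [set `|f v| | v in [set v : V | `|v| <= 1]].
Proof.
move=> [M fM]; split; first by exists `|f 0|, 0 => //=; rewrite normr0.
exists `|M| => _ [v /= v1 <-]; rewrite (le_trans (fM v))//.
rewrite (@le_trans _ _ (`|M| * `|v|)) ?ler_wpM2r ?ler_norm//.
by rewrite ler_piMr.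
Qed.

Lemma opnorm_ge0 V W (f : V -> W) : bounded_operator f -> 0 <= opnorm f.
Proof.
move=> fb; rewrite (le_trans (normr_ge0 (f 0)))//.
by apply: (sup_upper_bound (opnorm_has_sup fb)); exists 0 => //=; rewrite normr0.
Qed.

Lemma opnorm_le V W (f : V -> W) (M : R) :
  (forall v, `|v| <= 1 -> `|f v| <= M) -> opnorm f <= M.
Proof.
move=> fM; apply: ge_sup; first by exists `|f 0|, 0 => //=; rewrite normr0.
by move=> _ [v /= v1 <-]; exact: fM.
Qed.

Lemma opnormP V (f : V -> R) : scalar f -> bounded_operator f ->
  forall v, `|f v| <= opnorm f * `|v|.
Proof.
move=> fl fb v.
have f0 : f 0 = 0.
  by have := fl (-1) 0 0; rewrite scaleN1r oppr0 addr0 mulN1r addNr.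
have [->|v0] := eqVneq v 0; first by rewrite f0 normr0 normr0 mulr0.
have nv0 : 0 < `|v| by rewrite normr_gt0.
rewrite -ler_pdivrMr//.
suff -> : `|f v| / `|v| = `|f (`|v|^-1 *: v)|.
  apply: (sup_upper_bound (opnorm_has_sup fb)); exists (`|v|^-1 *: v) => //=.
  by rewrite normrZ ger0_norm ?invr_ge0// mulVf// gt_eqF.
have := fl `|v|^-1 v 0; rewrite f0 !addr0 => ->.
by rewrite normrM mulrC ger0_norm// invr_ge0.
Qed.

Definition bounded_approximation_property (lambda : R)
    (Y : normedModType R) : Prop :=
  forall (eps : R) (C : set Y), 0 < eps -> compact C ->
    exists T : {linear Y -> Y},
      [/\ bounded_operator T, finite_rank T, opnorm T <= lambda &
          forall y, C y -> `|T y - y| <= eps].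

End operator_norm.

Section dual_theory.
Context {R : realType} (V : normedModType R).

Definition dual_pred : {pred V -> R} :=
  [pred f | `[< scalar f /\ bounded_operator f >]].

Record dual_space := Dual { dual_fun :> V -> R ; dual_subproof : dual_fun \in dual_pred }.

HB.instance Definition _ := [isSub for dual_fun].
HB.instance Definition _ := [Choice of dual_space by <:].

Lemma dual_linear (phi : dual_space) : scalar phi.
Proof. by have /asboolP[] := dual_subproof phi. Qed.

Lemma dual_bounded (phi : dual_space) : bounded_operator phi.
Proof. by have /asboolP[] := dual_subproof phi. Qed.

Lemma dual_submod_closed : submod_closed dual_pred.
Proof.
split.
  apply/asboolP; split; first by move=> a u v; rewrite mulr0 addr0.
  by exists 0 => v; rewrite normr0 mul0r.
move=> a f g /asboolP[fl [M fM]] /asboolP[gl [N gN]].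
apply/asboolP; split.
  move=> b u v; rewrite -[LHS]/(a * f (b *: u + v) + g (b *: u + v)).
  rewrite -[RHS]/(b * (a * f u + g u) + (a * f v + g v)) fl gl !mulrDr.
  by rewrite mulrCA addrACA.
exists (`|a| * M + N) => v; rewrite -[X in `|X|]/(a * f v + g v).
rewrite (le_trans (ler_normD _ _))// mulrDl lerD// normrM -mulrA.
exact: ler_wpM2l.
Qed.

HB.instance Definition _ := GRing.isSubmodClosed.Build _ _ dual_pred
  dual_submod_closed.
HB.instance Definition _ := [SubChoice_isSubLmodule of dual_space by <:].

Let dual_norm (phi : dual_space) : R := opnorm phi.

Let dual_normD phi psi : dual_norm (phi + psi) <= dual_norm phi + dual_norm psi.
Proof.
apply: opnorm_le => v v1; rewrite -[X in `|X|]/(phi v + psi v).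
rewrite (le_trans (ler_normD _ _))// lerD//.
- rewrite (le_trans (opnormP (@dual_linear phi) (@dual_bounded phi) v))//.
  by rewrite ler_piMr// opnorm_ge0//; exact: dual_bounded.
- rewrite (le_trans (opnormP (@dual_linear psi) (@dual_bounded psi) v))//.
  by rewrite ler_piMr// opnorm_ge0//; exact: dual_bounded.
Qed.

Let dual_normZ (a : R) phi : dual_norm (a *: phi) = `|a| * dual_norm phi.
Proof.
have le_normZ b psi : dual_norm (b *: psi) <= `|b| * dual_norm psi.
  apply: opnorm_le => v v1; rewrite -[X in `|X|]/(b * psi v) normrM.
  rewrite ler_wpM2l//.
  rewrite (le_trans (opnormP (@dual_linear psi) (@dual_bounded psi) v))//.
  by rewrite ler_piMr// opnorm_ge0//; exact: dual_bounded.
apply/eqP; rewrite eq_le le_normZ/=.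
have [->|a0] := eqVneq a 0.
  by rewrite normr0 mul0r; apply/opnorm_ge0/dual_bounded.
rewrite -{1}[phi](scalerK a0).
rewrite (le_trans (ler_wpM2l (normr_ge0 a) (le_normZ _ _)))//.
by rewrite normfV mulrA mulfV ?mul1r// normr_eq0.
Qed.

Let dual_norm0_eq0 phi : dual_norm phi = 0 -> phi = 0.
Proof.
move=> phi0; apply/val_inj/funext => v.
have := opnormP (@dual_linear phi) (@dual_bounded phi) v.
by rewrite -/(dual_norm phi) phi0 mul0r normr_le0 => /eqP.
Qed.

HB.instance Definition _ := Lmodule_isNormed.Build R dual_space
  dual_normD dual_normZ dual_norm0_eq0.

Lemma dual_normE (phi : dual_space) : `|phi| = opnorm phi.
Proof. by []. Qed.

Lemma dual_normP (phi : dual_space) v : `|phi v| <= `|phi| * `|v|.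
Proof. exact: opnormP (@dual_linear phi) (@dual_bounded phi) v. Qed.

Lemma dual_norm_le (phi : dual_space) (M : R) :
  (forall v, `|v| <= 1 -> `|phi v| <= M) -> `|phi| <= M.
Proof. exact: opnorm_le. Qed.

End dual_theory.

Section Lip0_space.
Context {R : realType} {X : metricType R}.

Definition lipschitz_with (k : R) (f : X -> R) : Prop :=
  forall x y, `|f x - f y| <= k * mdist x y.

(* The pairs with x = y contribute 0 / 0 = 0. *)
Definition lipschitz_constant (f : X -> R) : R :=
  sup [set `|f p.1 - f p.2| / mdist p.1 p.2 | p in [set: X * X]].

Definition Lip0_pred (xbar : X) : {pred X -> R} :=
  [pred f | `[< f xbar = 0 /\ exists k, lipschitz_with k f >]].

Record Lip0 (xbar : X) := MkLip0 {
  Lip0_fun :> X -> R ;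
  Lip0_subproof : Lip0_fun \in Lip0_pred xbar }.

Variable xbar : X.

HB.instance Definition _ := [isSub for @Lip0_fun xbar].
HB.instance Definition _ := [Choice of Lip0 xbar by <:].

Lemma Lip0_base (f : Lip0 xbar) : f xbar = 0.
Proof. by have /asboolP[] := Lip0_subproof f. Qed.

Lemma Lip0_lipschitz (f : Lip0 xbar) : exists k, lipschitz_with k f.
Proof. by have /asboolP[] := Lip0_subproof f. Qed.

Lemma Lip0_submod_closed : submod_closed (Lip0_pred xbar).
Proof.
split.
  apply/asboolP; split => //; exists 0 => x y.
  by rewrite mul0r subrr normr0.
move=> a f g /asboolP[f0 [M fM]] /asboolP[g0 [N gN]].
apply/asboolP; split.
  by rewrite -[LHS]/(a * f xbar + g xbar) f0 g0 mulr0 addr0.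
exists (`|a| * M + N) => x y.
rewrite -[X in `|X|]/(a * f x + g x - (a * f y + g y)).
rewrite opprD addrACA -mulrBr (le_trans (ler_normD _ _))// mulrDl lerD//.
by rewrite normrM -mulrA ler_wpM2l.
Qed.

HB.instance Definition _ := GRing.isSubmodClosed.Build _ _ (Lip0_pred xbar)
  Lip0_submod_closed.
HB.instance Definition _ := [SubChoice_isSubLmodule of Lip0 xbar by <:].

Lemma lipschitz_constant_le (f : X -> R) (M : R) : 0 <= M ->
  lipschitz_with M f -> lipschitz_constant f <= M.
Proof.
move=> M0 fM; apply: ge_sup; first by exists (`|f xbar - f xbar| / mdist xbar xbar), (xbar, xbar).
move=> _ [[x y] _ <-] /=; have [->|xy] := eqVneq x y.
  by rewrite subrr normr0 mul0r.
by rewrite ler_pdivrMr ?mdist_gt0.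
Qed.

Lemma lipschitz_constant_has_sup (f : Lip0 xbar) :
  has_sup [set `|f p.1 - f p.2| / mdist p.1 p.2 | p in [set: X * X]].
Proof.
have [k fk] := Lip0_lipschitz f.
split; first by exists (`|f xbar - f xbar| / mdist xbar xbar), (xbar, xbar).
exists `|k| => _ [[u v] _ <-] /=; have [->|uv] := eqVneq u v.
  by rewrite subrr normr0 mul0r.
rewrite ler_pdivrMr ?mdist_gt0// (le_trans (fk _ _))//.
by rewrite ler_wpM2r ?mdist_ge0 ?ler_norm.
Qed.

Lemma lipschitz_constant_ge0 (f : Lip0 xbar) : 0 <= lipschitz_constant f.
Proof.
rewrite (@le_trans _ _ (`|f xbar - f xbar| / mdist xbar xbar))//.
  by rewrite divr_ge0 ?mdist_ge0.
by apply: (sup_upper_bound (lipschitz_constant_has_sup f)); exists (xbar, xbar).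
Qed.

Lemma lipschitz_constantP (f : Lip0 xbar) :
  lipschitz_with (lipschitz_constant f) f.
Proof.
move=> x y; have [->|xy] := eqVneq x y.
  by rewrite subrr normr0 mdistxx mulr0.
rewrite -ler_pdivrMr ?mdist_gt0//.
by apply: (sup_upper_bound (lipschitz_constant_has_sup f)); exists (x, y).
Qed.


Let Lip0_norm (f : Lip0 xbar) : R := lipschitz_constant f.

Let Lip0_normD f g : Lip0_norm (f + g) <= Lip0_norm f + Lip0_norm g.
Proof.
apply: lipschitz_constant_le => [|x y].
  by rewrite addr_ge0 ?lipschitz_constant_ge0.
rewrite -[X in `|X|]/(f x + g x - (f y + g y)) opprD addrACA mulrDl.
by rewrite (le_trans (ler_normD _ _))// lerD//; exact: lipschitz_constantP.
Qed.

Let Lip0_normZ (a : R) f : Lip0_norm (a *: f) = `|a| * Lip0_norm f.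
Proof.
have le_normZ b g : Lip0_norm (b *: g) <= `|b| * Lip0_norm g.
  apply: lipschitz_constant_le => [|x y].
    by rewrite mulr_ge0 ?lipschitz_constant_ge0.
  rewrite -[X in `|X|]/(b * g x - b * g y) -mulrBr normrM -mulrA ler_wpM2l//.
  exact: lipschitz_constantP.
apply/eqP; rewrite eq_le le_normZ/=.
have [->|a0] := eqVneq a 0.
  by rewrite normr0 mul0r; exact: lipschitz_constant_ge0.
rewrite -{1}[f](scalerK a0).
rewrite (le_trans (ler_wpM2l (normr_ge0 a) (le_normZ _ _)))//.
by rewrite normfV mulrA mulfV ?mul1r// normr_eq0.
Qed.

Let Lip0_norm0_eq0 f : Lip0_norm f = 0 -> f = 0.
Proof.
move=> f0; apply/val_inj/funext => x.
have := lipschitz_constantP f x xbar.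
by rewrite -/(Lip0_norm f) f0 mul0r normr_le0 Lip0_base subr0 => /eqP.
Qed.

HB.instance Definition _ := Lmodule_isNormed.Build R (Lip0 xbar)
  Lip0_normD Lip0_normZ Lip0_norm0_eq0.

Lemma Lip0_normE (f : Lip0 xbar) : `|f| = lipschitz_constant f.
Proof. by []. Qed.

Lemma Lip0_normP (f : Lip0 xbar) x y : `|f x - f y| <= `|f| * mdist x y.
Proof. exact: lipschitz_constantP. Qed.

Lemma Lip0_norm_le (f : Lip0 xbar) (M : R) : 0 <= M ->
  lipschitz_with M f -> `|f| <= M.
Proof. exact: lipschitz_constant_le. Qed.

End Lip0_space.

Section free_theory.
Context {R : realType} {X : metricType R} (xbar : X).

Lemma evaluation_subproof (x : X) :
  (fun f : Lip0 xbar => f x) \in @dual_pred R (Lip0 xbar).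
Proof.
apply/asboolP; split=> //; exists (mdist x xbar) => f.
by rewrite mulrC -[f x]subr0 -(Lip0_base f); exact: Lip0_normP.
Qed.

Definition evaluation (x : X) : dual_space (Lip0 xbar) :=
  Dual (evaluation_subproof x).

Definition free_pred : {pred dual_space (Lip0 xbar)} :=
  [pred mu | `[< closure (lspan (range evaluation)) mu >]].

Record free_space := Free {
  free_val :> dual_space (Lip0 xbar) ;
  free_subproof : free_val \in free_pred }.

HB.instance Definition _ := [isSub for free_val].
HB.instance Definition _ := [Choice of free_space by <:].

Lemma free_submod_closed : submod_closed free_pred.
Proof.
split; first by apply/asboolP/subset_closure; exact: lspan0.
move=> a mu eta /asboolP mucl /asboolP etacl; apply/asboolP.
by apply: closure_submod => //; [exact: lspan0|move=> *; exact: lspanP].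
Qed.

HB.instance Definition _ := GRing.isSubmodClosed.Build _ _ free_pred
  free_submod_closed.
HB.instance Definition _ := [SubChoice_isSubLmodule of free_space by <:].

Let free_norm (mu : free_space) : R := `|free_val mu|.

Let free_normD mu eta : free_norm (mu + eta) <= free_norm mu + free_norm eta.
Proof. exact: ler_normD. Qed.

Let free_normZ (a : R) mu : free_norm (a *: mu) = `|a| * free_norm mu.
Proof. exact: normrZ. Qed.

Let free_norm0_eq0 mu : free_norm mu = 0 -> mu = 0.
Proof. by move=> /normr0_eq0 mu0; exact: val_inj. Qed.

HB.instance Definition _ := Lmodule_isNormed.Build R free_space
  free_normD free_normZ free_norm0_eq0.

Lemma free_normE (mu : free_space) : `|mu| = `|free_val mu|.
Proof. by []. Qed.

Lemma delta_subproof (x : X) : evaluation x \in free_pred.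
Proof.
apply/asboolP/subset_closure; exists [:: (1, evaluation x)].
  by move=> p; rewrite inE => /eqP -> /=; exists x.
by rewrite big_seq1 scale1r.
Qed.

Definition delta (x : X) : free_space := Free (delta_subproof x).

Definition W1 (mu eta : free_space) : R := `|mu - eta|.

End free_theory.

Section free_embedding.
Context {R : realType} {X : metricType R} (xbar : X) (A : set X).
Hypothesis hA : xbar \in A.

Definition sub_base : A := exist _ xbar hA.

Lemma Lip0_restrict_subproof (f : Lip0 xbar) :
  f \o set_val \in Lip0_pred sub_base.
Proof.
apply/asboolP; split; first exact: Lip0_base.
by exists `|f| => x y; exact: (Lip0_normP f (set_val x) (set_val y)).
Qed.

Definition Lip0_restrict (f : Lip0 xbar) : Lip0 sub_base :=
  MkLip0 (Lip0_restrict_subproof f).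

Lemma Lip0_restrict_norm f : `|Lip0_restrict f| <= `|f|.
Proof.
apply: Lip0_norm_le => // x y; exact: (Lip0_normP f (set_val x) (set_val y)).
Qed.

Lemma Lip0_restrictP a f g :
  Lip0_restrict (a *: f + g) = a *: Lip0_restrict f + Lip0_restrict g.
Proof. exact/val_inj. Qed.

Lemma dual_embed_subproof (mu : dual_space (Lip0 sub_base)) :
  (fun f => mu (Lip0_restrict f)) \in @dual_pred R (Lip0 xbar).
Proof.
apply/asboolP; split.
  by move=> a f g; rewrite Lip0_restrictP dual_linear.
exists `|mu| => f; rewrite (le_trans (dual_normP _ _))//.
by rewrite ler_wpM2l// Lip0_restrict_norm.
Qed.

Definition dual_embed (mu : dual_space (Lip0 sub_base)) : dual_space (Lip0 xbar) :=
  Dual (dual_embed_subproof mu).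

Lemma dual_embedP a mu eta :
  dual_embed (a *: mu + eta) = a *: dual_embed mu + dual_embed eta.
Proof. exact/val_inj. Qed.

Lemma dual_embed_norm mu : `|dual_embed mu| <= `|mu|.
Proof.
apply: dual_norm_le => f f1; rewrite -[X in `|X|]/(mu (Lip0_restrict f)).
rewrite (le_trans (dual_normP _ _))//.
by rewrite ler_piMr// (le_trans (Lip0_restrict_norm _)).
Qed.

Lemma free_embed_subproof (mu : free_space sub_base) :
  dual_embed mu \in @free_pred R X xbar.
Proof.
apply/asboolP/closure_normP => e e0.
have /asboolP/closure_normP/(_ _ e0)[_ [s sev ->] mus] := free_subproof mu.
have embedB u v : dual_embed (u - v) = dual_embed u - dual_embed v.
  exact/val_inj.
set w := \sum_(_ <- _) _ in mus.
exists (dual_embed w); last first.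
  by rewrite -embedB (le_lt_trans (dual_embed_norm _)).
rewrite {mus}/w; elim: s sev => [_|p s IHs sev].
  rewrite big_nil (_ : dual_embed 0 = 0); first exact: lspan0.
  exact/val_inj.
rewrite big_cons dual_embedP; apply: lspanP; last first.
  by apply: IHs => q qs; apply: sev; rewrite inE qs orbT.
have [x _ <-] := sev p (mem_head _ _).
exists [:: (1, evaluation xbar (set_val x))].
  by move=> q; rewrite inE => /eqP -> /=; exists (set_val x).
by rewrite big_seq1 scale1r; exact/val_inj.
Qed.

Definition free_embed (mu : free_space sub_base) : free_space xbar :=
  Free (free_embed_subproof mu).

Lemma free_embedE mu f : free_embed mu f = mu (Lip0_restrict f).
Proof. by []. Qed.

End free_embedding.

Section random_projection.
Context {R : realType} {X : metricType R} (xbar : X).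

Definition asymptotic_random_projection (K : R) (M : nat -> set X)
    (hM : forall n, xbar \in M n) : Prop :=
  exists upsilon : forall n, X -> free_space (sub_base (hM n)),
    (forall x, (\bigcup_n M n) x ->
       W1 (free_embed (upsilon n x)) (delta xbar x) @[n --> \oo] --> (0 : R)) /\
    (forall x y n,
       W1 (free_embed (upsilon n x)) (free_embed (upsilon n y))
         <= K * mdist x y).

End random_projection.

Arguments asymptotic_random_projection {R X xbar} K M hM.

Section initial_sets.
Context {R : realType} {X : metricType R}.

Definition initial_set (x : nat -> X) (n : nat) : set X := x @` `I_n.+1.

Lemma mem_initial_set (xbar : X) (x : nat -> X) : x 0%N = xbar ->
  forall n, xbar \in initial_set x n.
Proof. by move=> <- n; apply/mem_set; exists 0%N. Qed.

End initial_sets.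

(* Main.v *)
(* From a random projection, the K-Lipschitz map x |-> upsilon_x^n - upsilon_xbar^n
   into the finite-dimensional space F(M_n) linearizes to a finite-rank operator
   T_n of norm at most K; T_n converges to the identity on a dense subspace, hence
   uniformly on compact sets. No completeness is needed: T_n is a finite sum
   mu |-> sum_j mu(a_j) y_j, and its norm is computed by duality against Lip0(X).
   Conversely, an operator given by the BAP is perturbed so that its finite-rank
   range lies in some F(M_m), rescaled to keep the norm at most K, evaluated at the
   delta_x, and the resulting family is reindexed so that step k lands in F(M_k).
   Elements of Lip0(X) separate points of F(X), so the identity of any
   finite-dimensional subspace is itself such a finite sum with bounded
   coordinate functionals. *)
From HB Require Import structures.
Require Import Defs.
From mathcomp Require Import all_boot all_order all_algebra.
From mathcomp Require Import all_classical all_reals.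
From mathcomp Require Import topology normedtype.
From mathcomp Require Import interval_inference.

Import Order.TTheory GRing.Theory Num.Theory.
Import numFieldNormedType.Exports.

Local Open Scope classical_set_scope.
Local Open Scope ring_scope.

(** * Submodules and linear spans *)

Section linear_span_theory.
Context {R : realType} {V : lmodType R}.
Implicit Types A P W : set V.

Definition submodule W : Prop :=
  W 0 /\ forall (a : R) u v, W u -> W v -> W (a *: u + v).

Lemma submodule_lspan A : submodule (lspan A).
Proof. by split; [exact: lspan0 | exact: lspanP]. Qed.

Lemma submoduleZ W (a : R) u : submodule W -> W u -> W (a *: u).
Proof. by move=> [W0 WP] Wu; rewrite -[_ *: _]addr0; exact: WP. Qed.

Lemma submoduleD W u v : submodule W -> W u -> W v -> W (u + v).
Proof. by move=> [W0 WP] Wu Wv; rewrite -[u]scale1r; exact: WP. Qed.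

Lemma submoduleB W u v : submodule W -> W u -> W v -> W (u - v).
Proof. by move=> WS Wu Wv; rewrite -scaleN1r addrC; exact: WS.2. Qed.

Lemma submodule_sum W (I : eqType) (s : seq I) (F : I -> V) : submodule W ->
  (forall i, i \in s -> W (F i)) -> W (\sum_(i <- s) F i).
Proof.
move=> WS; elim: s => [|i s IHs] Fs; first by rewrite big_nil; exact: WS.1.
rewrite big_cons; apply: submoduleD => //; first by apply: Fs; rewrite mem_head.
by apply: IHs => j js; apply: Fs; rewrite inE js orbT.
Qed.

Lemma sub_lspan A : A `<=` lspan A.
Proof.
move=> v Av; exists [:: (1, v)]; last by rewrite big_seq1 scale1r.
by move=> p; rewrite inE => /eqP ->.
Qed.

Lemma lspan_min A W : submodule W -> A `<=` W -> lspan A `<=` W.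
Proof.
move=> WS AW _ [s sA ->]; apply: submodule_sum => // p ps.
by apply: submoduleZ => //; apply/AW/sA.
Qed.

Lemma lspan_mono A B : A `<=` B -> lspan A `<=` lspan B.
Proof.
move=> AB; apply: lspan_min; first exact: submodule_lspan.
exact: subset_trans AB (@sub_lspan B).
Qed.

Lemma lspan_cons y (s : seq V) v : lspan [set` y :: s] v ->
  exists a : R, lspan [set` s] (v - a *: y).
Proof.
move: v; apply: lspan_min => [|z /=].
  split; first by exists 0; rewrite scale0r subr0; exact: lspan0.
  move=> a u v [b ub] [c vc]; exists (a * b + c).
  rewrite scalerDl opprD addrACA -scalerA -scalerBr; exact: lspanP.
rewrite inE => /orP[/eqP ->|zs].
  by exists 1; rewrite scale1r subrr; exact: lspan0.
by exists 0; rewrite scale0r subr0; exact: sub_lspan.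
Qed.

(** Serves [finite_rank], which asks for a finite set spanning the range exactly, where only an
    inclusion is at hand. By induction on [s], generators of the part of [W] in the span of the tail
    are completed by one vector of [W] with nonzero coefficient along the head, if there is one. *)
Lemma submodule_finite_lspan (s : seq V) W : submodule W ->
  W `<=` lspan [set` s] -> exists2 S : set V, finite_set S & W = lspan S.
Proof.
elim: s W => [|y s IHs] W WS Ws.
  exists set0 => //; apply/seteqP; split; last exact: lspan_min.
  by move=> v /Ws [t tA ->]; exists t => // p /tA.
have W'S : submodule (W `&` lspan [set` s]).
  split; first by split; [exact: WS.1|exact: lspan0].
  move=> a u v [Wu su] [Wv sv].
  by split; [exact: WS.2|exact: lspanP].
have [S Sfin SE] := IHs _ W'S (@subIsetr _ _ _).
have [[w [a [Ww a0 wa]]]|noW] :=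
    pselect (exists w a, [/\ W w, a != 0 & lspan [set` s] (w - a *: y)]).
  exists (w |` S); first by rewrite finite_setU; split.
  apply/seteqP; split => [v Wv|].
    have [b vb] := lspan_cons _ _ _ (Ws _ Wv).
    have WSv : lspan S (v - (b / a) *: w).
      rewrite -SE; split; first by apply: submoduleB => //; exact: submoduleZ.
      rewrite (_ : _ - _ = (- (b / a)) *: (w - a *: y) + (v - b *: y)).
        exact: lspanP.
      rewrite scalerBr scalerA mulNr mulfVK// !scaleNr opprK.
      by rewrite [RHS]addrC addrACA addNr addr0.
    rewrite -(subrK ((b / a) *: w) v); apply: submoduleD.
    - exact: submodule_lspan.
    - by apply: lspan_mono WSv; exact: subsetUr.
    - by apply: submoduleZ; [exact: submodule_lspan|apply: sub_lspan; left].
  apply: lspan_min => // v [-> //|Sv].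
  by have [] : (W `&` lspan [set` s]) v by rewrite SE; exact: sub_lspan.
exists S => //; rewrite -SE; apply/seteqP; split=> [v Wv|v []//].
split => //; have [a va] := lspan_cons _ _ _ (Ws _ Wv).
have [a0|a0] := eqVneq a 0; first by rewrite a0 scale0r subr0 in va.
by exfalso; apply: noW; exists v, a.
Qed.

End linear_span_theory.

Lemma submodule_range {R : realType} {U V : lmodType R} (f : {linear U -> V}) :
  submodule (range f).
Proof.
split; first by exists 0; rewrite ?linear0.
by move=> a _ _ [u _ <-] [v _ <-]; exists (a *: u + v); rewrite ?linearP.
Qed.

(** * Closures and norm estimates *)

Section normed_theory.
Context {R : realType}.

Lemma submodule_closure (V : normedModType R) (W : set V) :
  submodule W -> submodule (closure W).
Proof.
by move=> [W0 WP]; split; [exact: subset_closure|exact: closure_submod].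
Qed.

Lemma ler_opnorm (V W : normedModType R) (f : {linear V -> W}) :
  bounded_operator f -> forall v, `|f v| <= opnorm f * `|v|.
Proof.
move=> fb v; have [->|v0] := eqVneq v 0; first by rewrite linear0 !normr0 mulr0.
have nv0 : 0 < `|v| by rewrite normr_gt0.
rewrite -ler_pdivrMr//; apply: (sup_upper_bound (opnorm_has_sup fb)).
have vV : `| `|v|^-1 | = `|v|^-1 by rewrite ger0_norm// invr_ge0.
exists (`|v|^-1 *: v) => /=; first by rewrite normrZ vV mulVf// gt_eqF.
by rewrite linearZ normrZ vV mulrC.
Qed.

Lemma le_addeps_mul (a b M : R) : 0 <= M ->
  (forall e, 0 < e -> a <= b + e * M) -> a <= b.
Proof.
move=> M0 H; apply/ler_addgt0Pr => e e0.
have M1 : 0 < M + 1 by rewrite ltr_wpDl.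
rewrite (le_trans (H (e / (M + 1)) _)) ?divr_gt0// lerD2l.
by rewrite mulrAC ler_pdivrMr// ler_pM2l// lerDl.
Qed.

End normed_theory.

(** * Duality between the free space and [Lip0], and finite sums of rank-one operators *)

Section free_space_theory.
Context {R : realType} {X : metricType R} (xbar : X).
Implicit Types (mu : free_space xbar) (f : Lip0 xbar)
  (L : seq (Lip0 xbar * free_space xbar)).

Lemma free_normP mu f : `|mu f| <= `|mu| * `|f|.
Proof. exact: dual_normP. Qed.

Lemma free_norm_le mu (M : R) : 0 <= M ->
  (forall f, `|mu f| <= M * `|f|) -> `|mu| <= M.
Proof.
move=> M0 muM; apply: dual_norm_le => f f1.
by rewrite (le_trans (muM f))// ler_piMr.
Qed.

Lemma free_valB mu eta f : (mu - eta) f = mu f - eta f.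
Proof. by []. Qed.

Lemma free_linearP mu (a : R) f g : mu (a *: f + g) = a * mu f + mu g.
Proof. exact: dual_linear. Qed.

Lemma free_val_sum (I : Type) (s : seq I) (F : I -> free_space xbar) f :
  (\sum_(i <- s) F i) f = \sum_(i <- s) F i f.
Proof. by elim/big_rec2: _ => // i y1 y2 _ <-. Qed.

Lemma free_val0r mu : mu 0 = 0.
Proof.
by have := free_linearP mu (-1) 0 0; rewrite scaleN1r oppr0 addr0 mulN1r addNr.
Qed.

Lemma free_sumr mu (I : Type) (s : seq I) (c : I -> R) (F : I -> Lip0 xbar) :
  mu (\sum_(i <- s) c i *: F i) = \sum_(i <- s) c i * mu (F i).
Proof.
elim: s => [|i s IHs]; first by rewrite !big_nil free_val0r.
by rewrite !big_cons free_linearP IHs.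
Qed.

Lemma free_neq0 mu : mu != 0 -> exists f, mu f = 1.
Proof.
move=> mu0; have [f muf] : exists f, mu f != 0.
  apply: contrapT => H; move/eqP: mu0; apply; do 2 apply: val_inj.
  by apply/funext => f; apply/eqP/negPn/negP => muf; apply: H; exists f.
exists ((mu f)^-1 *: f + 0).
by rewrite free_linearP mulVf// free_val0r addr0.
Qed.

Lemma delta_base : delta xbar xbar = 0.
Proof. by do 2 apply: val_inj; apply/funext => f; exact: Lip0_base. Qed.

Lemma dist_delta (y z : X) : `|delta xbar y - delta xbar z| <= mdist y z.
Proof.
apply: free_norm_le => [|f]; first exact: mdist_ge0.
by rewrite mulrC; exact: Lip0_normP.
Qed.

(** [free_pred] takes the closure in the dual of [Lip0]; the approximants themselves lie in the free
    space, which carries the restricted norm, so density holds inside the free space too. *)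
Lemma closure_span_delta mu : closure (lspan (range (delta xbar))) mu.
Proof.
apply/closure_normP => e e0.
have /asboolP/closure_normP/(_ _ e0)[nu nus munu] := free_subproof mu.
suff [eta etas etaE] : (@free_val R X xbar @` lspan (range (delta xbar))) nu.
  by exists eta => //; rewrite free_normE -[free_val _]/(free_val mu - free_val eta) etaE.
move: nus {munu}; apply: lspan_min => [|_ [z _ <-]].
  split; first by exists 0 => //; exact: lspan0.
  move=> a _ _ [u su <-] [v sv <-]; exists (a *: u + v) => //.
  exact: lspanP.
by exists (delta xbar z) => //; apply: sub_lspan; exists z.
Qed.

Lemma closure_span_dense (x : nat -> X) mu : dense (range x) ->
  closure (lspan (delta xbar @` range x)) mu.
Proof.
move=> xd; set W := lspan _.
suff : lspan (range (delta xbar)) `<=` closure W.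
  move=> /closureS/(_ _ (closure_span_delta mu)).
  by rewrite -(iffLR (closure_id _) (@closed_closure _ W)).
apply: lspan_min.
  by apply: submodule_closure; exact: submodule_lspan.
move=> _ [z _ <-]; apply/closure_normP => e e0.
have [||y [/interior_subset ze [n _ xn]]] := xd (ball z e)^°.
- by exists z; exact: nbhsx_ballx.
- exact: open_interior.
exists (delta xbar y).
  by apply: sub_lspan; exists y => //; exists n.
by rewrite (le_lt_trans (dist_delta _ _))//; move: ze; rewrite ballEmdist.
Qed.

(** The operator of the tensor sum of the [p.1] and [p.2]: each element of [Lip0] acts on the free
    space as a bounded functional. *)
Definition pairing L mu := \sum_(p <- L) mu p.1 *: p.2.

Lemma pairing_is_linear L : linear (pairing L).
Proof.
move=> a mu eta; rewrite /pairing scaler_sumr -big_split/=.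
by apply: eq_bigr => p _; rewrite scalerA -scalerDl.
Qed.

HB.instance Definition _ L := GRing.isLinear.Build R _ _ _ (pairing L)
  (pairing_is_linear L).

Lemma pairing_bounded L : bounded_operator (pairing L).
Proof.
exists (\sum_(p <- L) `|p.1| * `|p.2|) => mu.
rewrite (le_trans (ler_norm_sum _ _ _))// mulr_suml ler_sum// => p _.
rewrite normrZ mulrAC ler_wpM2r// mulrC; exact: free_normP.
Qed.

(** A new generator [y] is either fixed by [pairing L] or leaves a nonzero residual [z]. In the
    second case, pick [f] with [z f = 1] and add the term [(mu - pairing L mu) f *: z]: it vanishes
    on the old span and restores [z] at [y]. *)
Lemma lspan_pairing (s : seq (free_space xbar)) : exists2 L,
  forall p, p \in L -> lspan [set` s] p.2 &
  forall mu, lspan [set` s] mu -> pairing L mu = mu.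
Proof.
elim: s => [|y s [L Ls LE]].
  exists [::] => // mu [t tA ->]; rewrite /pairing big_nil.
  by case: t tA => [|p t] tA; [rewrite big_nil|have := tA p (mem_head _ _)].
have ssub : [set` s] `<=` [set` y :: s] by move=> v /= vs; rewrite inE vs orbT.
have Lsub p : p \in L -> lspan [set` y :: s] p.2.
  by move=> /Ls; exact: lspan_mono.
pose z := y - pairing L y; have [z0|/free_neq0[f zf]] := eqVneq z 0.
  exists L => // mu /lspan_cons[a /LE]; rewrite linearB linearZ/=.
  move/subr0_eq: z0 => <-; exact: addIr.
(* The subtracted sum is the transpose of [pairing L] applied to [f], so [g] evaluates the residual
   of [mu] at [f]. *)
pose g := f - \sum_(p <- L) p.2 f *: p.1.
have gE mu : mu g = (mu - pairing L mu) f.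
  rewrite /g addrC -scaleN1r free_linearP free_sumr free_valB free_val_sum.
  rewrite mulN1r addrC; congr (_ - _); apply: eq_bigr => p _; exact: mulrC.
have PE mu : pairing ((g, z) :: L) mu = (mu - pairing L mu) f *: z + pairing L mu.
  by rewrite /pairing big_cons/= gE.
exists ((g, z) :: L) => [p|mu /lspan_cons[a /LE muL]].
  rewrite inE => /orP[/eqP -> /=|]; last exact: Lsub.
  apply: submoduleB; first exact: submodule_lspan.
    by apply: sub_lspan; rewrite /= mem_head.
  apply: submodule_sum; first exact: submodule_lspan.
  by move=> q /Lsub; apply: submoduleZ; exact: submodule_lspan.
move: muL; set v := mu - a *: y => vL.
have -> : mu = v + a *: y by rewrite subrK.
rewrite linearD linearZ/= !PE vL subrr zf scale1r.
by rewrite -[(0 : free_space xbar) f]/0 scale0r add0r subrK.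
Qed.

(** The operator from [lspan_pairing] is bounded, maps into the span and is the identity there; by
    continuity it also fixes every limit point. *)
Lemma closure_lspan_seq (s : seq (free_space xbar)) :
  closure (lspan [set` s]) `<=` lspan [set` s].
Proof.
have [L Ls LE] := lspan_pairing s; have [M ML] := pairing_bounded L.
move=> mu /closure_normP mucl; suff <- : pairing L mu = mu.
  apply: submodule_sum; first exact: submodule_lspan.
  by move=> p /Ls; apply: submoduleZ; exact: submodule_lspan.
apply/eqP; rewrite -subr_eq0 -normr_le0.
apply: (@le_addeps_mul _ _ _ (`|M| + 1)) => [|e e0]; first by rewrite addr_ge0.
have [nu nus munu] := mucl e e0.
rewrite add0r (_ : _ - _ = pairing L (mu - nu) - (mu - nu)); last first.
  by rewrite linearB/= (LE _ nus) opprB addrA subrK.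
rewrite (le_trans (ler_normB _ _))// mulrDr mulr1 lerD//; last exact: ltW.
rewrite (le_trans (ML _))// mulrC (le_trans (ler_wpM2l _ (ler_norm M)))//.
by rewrite ler_wpM2r// ltW.
Qed.

End free_space_theory.

(** * Strong convergence to the identity under a uniform bound *)

Section strong_convergence.
Context {R : realType} {V : normedModType R}.
Variables (T : nat -> {linear V -> V}) (K : R).
Hypotheses (K0 : 0 <= K) (TK : forall n v, `|T n v| <= K * `|v|).

Lemma submodule_cvg_id : submodule [set v | T n v @[n --> \oo] --> v].
Proof.
split => [|a u v Tu Tv] /=.
  under eq_fun do rewrite linear0; exact: cvg_cst.
under eq_fun do rewrite linearP.
by apply: cvgD => //; exact: cvgZr.
Qed.

(** Moving to a nearby point costs a factor independent of [n]; hence convergence passes to closures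
    and is uniform on compact sets. *)
Lemma dist_op_le n (v w : V) : `|v - T n v| <= (K + 1) * `|v - w| + `|w - T n w|.
Proof.
rewrite (_ : v - T n v = (v - w) - T n (v - w) + (w - T n w)); last first.
  by rewrite linearB opprB [RHS]addrACA subrK
    [Y in _ = _ + Y]addrAC subrr add0r.
rewrite (le_trans (ler_normD _ _))// lerD2r mulrDl mul1r [leRHS]addrC.
by rewrite (le_trans (ler_normB _ _))// lerD2l.
Qed.

Lemma cvg_id_closure (W : set V) :
  (forall w, W w -> T n w @[n --> \oo] --> w) ->
  forall v, closure W v -> T n v @[n --> \oo] --> v.
Proof.
move=> TW v /closure_normP vW; apply/cvgrPdist_le => e e0.
have K1 : 0 < K + 1 by rewrite ltr_wpDl.
have [w Ww vw] := vW (e / 2 / (K + 1)) ltac:(by rewrite !divr_gt0).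
have /cvgrPdist_le/(_ (e / 2)) := TW _ Ww.
move=> /(_ ltac:(by rewrite divr_gt0)); apply: filterS => n Tw.
rewrite (le_trans (dist_op_le n v w))// [leRHS]splitr lerD//.
by rewrite mulrC -ler_pdivlMr// ltW.
Qed.

Lemma cvg_id_compact (C : set V) (e : R) :
  (forall v, T n v @[n --> \oo] --> v) -> 0 < e -> compact C ->
  \forall n \near \oo, forall v, C v -> `|T n v - v| <= e.
Proof.
move=> Tcvg e0 /compact_near_coveringP Cnear.
apply: (Cnear nat \oo (fun n v => `|T n v - v| <= e)) => v Cv.
have K1 : 0 < K + 1 by rewrite ltr_wpDl.
have /cvgrPdist_le/(_ (e / 2)) := Tcvg v.
move=> /(_ ltac:(by rewrite divr_gt0)) nv.
exists (ball v (e / 2 / (K + 1)), [set n | `|v - T n v| <= e / 2]).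
  by split => //=; apply: nbhsx_ballx; rewrite !divr_gt0.
case=> w n /= [vw Tv]; rewrite distrC (le_trans (dist_op_le n w v))//.
rewrite [leRHS]splitr lerD// mulrC -ler_pdivlMr// distrC ltW//.
by move: vw; rewrite -ball_normE.
Qed.

End strong_convergence.

(** * Images of embedded free spaces as spans of deltas *)

Section free_embed_theory.
Context {R : realType} {X : metricType R} (xbar : X) (A : set X).
Variable hA : xbar \in A.

Lemma free_embed_is_linear : linear (@free_embed R X xbar A hA).
Proof. by move=> a mu eta; do 2 apply: val_inj. Qed.

HB.instance Definition _ := GRing.isLinear.Build R _ _ _
  (@free_embed R X xbar A hA) free_embed_is_linear.

Lemma free_embed_delta (z : A) :
  free_embed (delta (sub_base hA) z) = delta xbar (set_val z).
Proof. by do 2 apply: val_inj. Qed.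

Lemma lspan_free_embed :
  lspan (delta xbar @` A) `<=` range (@free_embed R X xbar A hA).
Proof.
apply: lspan_min => [|_ [z Az <-]]; first exact: submodule_range.
by exists (delta (sub_base hA) (SigSub (mem_set Az))) => //;
  rewrite free_embed_delta.
Qed.

(** For finite [A] the span is closed by [closure_lspan_seq], so together with [lspan_free_embed]
    this identifies the image with a span of deltas. *)
Lemma closure_free_embed mu :
  closure (lspan (delta xbar @` A)) (@free_embed R X xbar A hA mu).
Proof.
apply/closure_normP => e e0.
have /closure_normP/(_ _ e0)[nu nus munu] := closure_span_delta _ mu.
exists (free_embed nu); last first.
  by rewrite -linearB (le_lt_trans (dual_embed_norm _)).
move: nu nus {munu}; apply: lspan_min => [|_ [z _ <-]] /=.
  split => [|a u v su sv]; first by rewrite linear0; exact: lspan0.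
  by rewrite linearP; exact: lspanP.
rewrite free_embed_delta; apply: sub_lspan; exists (set_val z) => //.
exact: set_valP.
Qed.

End free_embed_theory.

(** * Linearization of Lipschitz maps and perturbation of finite-rank operators *)

Section approximation.
Context {R : realType} {X : metricType R} (xbar : X).

Lemma W1_cvgP (u : nat -> free_space xbar) mu :
  (W1 (u n) mu @[n --> \oo] --> (0 : R)) <-> (u n @[n --> \oo] --> mu).
Proof.
rewrite cvgr0Pnorm_le cvgrPdist_le; split => H e /H; apply: filterS => n;
  by rewrite /W1 distrC normr_id.
Qed.

(** In a finite sum representing the identity of the span, each functional [f] is replaced by the
    function sending [z] to [(u z - u xbar) f]. Subtracting [u xbar] places it in [Lip0]. *)
Lemma lipschitz_linearization (s : seq (free_space xbar)) (K : R)
    (u : X -> free_space xbar) : 0 <= K ->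
  (forall z, lspan [set` s] (u z)) ->
  (forall y z, `|u y - u z| <= K * mdist y z) ->
  exists L, [/\ forall p, p \in L -> lspan [set` s] p.2,
    forall mu, `|pairing xbar L mu| <= K * `|mu| &
    forall z, pairing xbar L (delta xbar z) = u z - u xbar].
Proof.
move=> K0 us uK; have [L0 L0s L0E] := lspan_pairing xbar s.
have /choice[a aE] f : exists g : Lip0 xbar, forall z, g z = (u z - u xbar) f.
  have gP : (fun z => (u z - u xbar) f) \in Lip0_pred xbar.
    apply/asboolP; split; first by rewrite subrr.
    exists (K * `|f|) => y z; rewrite -free_valB opprB addrA subrK.
    by rewrite (le_trans (free_normP _ _ _))// mulrAC ler_wpM2r.
  by exists (MkLip0 gP).
pose L := [seq (a p.1, p.2) | p <- L0].
have Ldelta z : pairing xbar L (delta xbar z) = u z - u xbar.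
  rewrite -[RHS]L0E; last by apply: submoduleB => //; exact: submodule_lspan.
  by rewrite /pairing big_map; apply: eq_bigr => p _; congr (_ *: _); exact: aE.
exists L; split => // [_ /mapP[p /L0s pL ->] //|mu].
apply: free_norm_le => [|f]; first exact: mulr_ge0.
(* The transpose of the operator applied to [f]: since [h z = (u z - u xbar) f], its Lipschitz
   constant is at most [K] times the norm of [f], whatever the norms of the separate terms. *)
pose h := \sum_(p <- L) p.2 f *: p.1.
have hE (nu : free_space xbar) : nu h = pairing xbar L nu f.
  by rewrite /h free_sumr free_val_sum; apply: eq_bigr => p _; exact: mulrC.
rewrite -hE (le_trans (free_normP _ _ _))// (mulrC K) -mulrA ler_wpM2l//.
apply: Lip0_norm_le => [|y z]; first exact: mulr_ge0.
rewrite -[h y]/(delta xbar y h) -[h z]/(delta xbar z h) !hE !Ldelta -free_valB.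
by rewrite opprB addrA subrK (le_trans (free_normP _ _ _))// mulrAC ler_wpM2r.
Qed.

(** Each vector is moved to a nearby one in the dense union, half of the remaining error being spent
    per term; monotonicity gathers the finitely many new vectors in one [D m]. *)
Lemma pairing_perturb (D : nat -> set (free_space xbar)) L (e : R) :
  {homo D : m n / (m <= n)%N >-> m `<=` n} ->
  (forall mu, closure (\bigcup_n D n) mu) -> 0 < e ->
  exists m L', (forall p, p \in L' -> D m p.2) /\
    forall mu, `|pairing xbar L' mu - pairing xbar L mu| <= e * `|mu|.
Proof.
move=> Dmono Ddense; elim: L e => [|[f y] L IHL] e e0.
  exists 0%N, [::]; split => // mu.
  by rewrite subrr normr0 mulr_ge0// ltW.
have [|m [L' [L'D L'L]]] := IHL (e / 2); first by rewrite divr_gt0.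
have f1 : 0 < `|f| + 1 by rewrite ltr_wpDl.
have /closure_normP/(_ (e / 2 / (`|f| + 1))) := Ddense y.
move=> /(_ ltac:(by rewrite !divr_gt0))[z [k _ Dkz] yz].
exists (maxn k m), ((f, z) :: L'); split => [p|mu].
  rewrite inE => /orP[/eqP -> /=|/L'D].
    by apply: Dmono Dkz; exact: leq_maxl.
  by apply: Dmono; exact: leq_maxr.
rewrite /pairing !big_cons/= opprD addrACA -scalerBr.
rewrite (le_trans (ler_normD _ _))// [e in leRHS]splitr mulrDl lerD//; last exact: L'L.
rewrite normrZ distrC (le_trans (ler_wpM2l _ (ltW yz)))//.
rewrite mulrCA ler_wpM2l//; first by rewrite divr_ge0// ltW.
by rewrite ler_pdivrMr// (le_trans (free_normP _ _ _))// ler_wpM2l// lerDl.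
Qed.

End approximation.

(** * From approximating operators to random projections and back *)

Section equivalence.
Context {R : realType} {X : metricType R} (xbar : X) (x : nat -> X).
Hypothesis x_dense : dense (range x).

Let D n : set (free_space xbar) := lspan (delta xbar @` initial_set x n).

Lemma initial_set_mono : {homo initial_set x : m n / (m <= n)%N >-> m `<=` n}.
Proof.
by move=> m n mn _ [i /= im <-]; exists i => //=; exact: leq_trans im _.
Qed.

Lemma span_initial_mono : {homo D : m n / (m <= n)%N >-> m `<=` n}.
Proof.
by move=> m n mn; apply/lspan_mono/image_subset/initial_set_mono.
Qed.

Lemma closure_span_initial mu : closure (\bigcup_n D n) mu.
Proof.
have := closure_span_dense _ x mu x_dense; apply: closureS; apply: lspan_min.
  split; first by exists 0%N => //; exact: lspan0.
  move=> a u v [m _ Du] [n _ Dv]; exists (maxn m n) => //; apply: lspanP.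
  - by apply: span_initial_mono Du; exact: leq_maxl.
  - by apply: span_initial_mono Dv; exact: leq_maxr.
move=> _ [_ [n _ <-] <-]; exists n => //; apply: sub_lspan.
by exists (x n) => //; exists n => //=.
Qed.

Lemma finite_initial_set n : finite_set (delta xbar @` initial_set x n).
Proof. by do 2 apply: finite_image; exact: finite_II. Qed.

(* In the error, the 1 comes from the operator supplied by the BAP, the rest
   from moving its range into D m and rescaling to keep the norm at most K. *)
Lemma BAP_lipschitz_approx (K : R) (N : nat) : 0 <= K ->
  bounded_approximation_property K (free_space xbar) ->
  exists m (u : X -> free_space xbar), [/\ forall z, D m (u z),
    forall y z, `|u y - u z| <= K * mdist y z &
    forall i, (i <= N)%N -> `|u (x i) - delta xbar (x i)| <=
      N.+1%:R^-1 * (1 + 2 * (K * mdist (x i) xbar))].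
Proof.
move=> K0 BAP; set e : R := N.+1%:R^-1.
have e0 : 0 < e by rewrite invr_gt0.
have [T [Tb [S Sfin TS] TK TC]] :=
  BAP e _ e0 (finite_compact (finite_initial_set N)).
have {}TK v : `|T v| <= K * `|v|.
  by rewrite (le_trans (ler_opnorm _ _ _ Tb _))// ler_wpM2r.
have [s sS] := iffLR (finite_seqP _) Sfin.
have [L0 _ L0E] := lspan_pairing xbar s.
have {}L0E v : pairing xbar L0 (T v) = T v.
  by apply: L0E; rewrite -sS -TS; exists v.
(* As [L0] is the identity on the range of [T], perturbing its vectors moves that range into [D m]
   with error at most [e] relative to the norm of [T v]. *)
have [m [L [LD LL0]]] :=
  pairing_perturb _ D L0 e span_initial_mono closure_span_initial e0.
have e1 : 0 < 1 + e by rewrite addr_gt0.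
pose Q v := (1 + e)^-1 *: pairing xbar L (T v).
have QB v w : Q (v - w) = Q v - Q w by rewrite /Q !linearB.
have QT v : `|pairing xbar L (T v) - T v| <= e * `|T v|.
  by rewrite -{2}L0E.
have QK v : `|Q v| <= K * `|v|.
  rewrite normrZ gtr0_norm ?invr_gt0// ler_pdivrMl//.
  rewrite -[pairing _ _ _](subrK (T v)) (le_trans (ler_normD _ _))//.
  rewrite (le_trans (lerD (QT v) (lexx _)))// -[X in _ + X]mul1r -mulrDl addrC.
  by rewrite ler_wpM2l// ltW.
exists m, (fun z => Q (delta xbar z)); split => [z|y z|i iN].
- apply: submoduleZ; first exact: submodule_lspan.
  apply: submodule_sum; first exact: submodule_lspan.
  by move=> p /LD; apply: submoduleZ; exact: submodule_lspan.
- rewrite -QB (le_trans (QK _))// ler_wpM2l//; exact: dist_delta.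
set v := delta xbar (x i).
have vd : `|v| <= mdist (x i) xbar.
  by rewrite -[v]subr0 -(delta_base xbar); exact: dist_delta.
have Tvd : `|T v| <= K * mdist (x i) xbar.
  by rewrite (le_trans (TK _))// ler_wpM2l.
have Tve : `|T v - v| <= e by apply: TC; exists (x i) => //; exists i.
(* In the bracket, perturbation and rescaling each contribute at most [e] times the norm of [T v],
   whence the factor 2 in the bound. *)
have -> : Q v - v = (1 + e)^-1 *: ((pairing xbar L (T v) - T v) - e *: T v)
    + (T v - v).
  rewrite -[_ - T v - _]addrA -opprD -{2}[T v]scale1r -scalerDl scalerBr scalerA.
  by rewrite mulVf ?gt_eqF// scale1r addrA subrK.
rewrite (le_trans (ler_normD _ _))// mulrDr mulr1 addrC lerD//.
rewrite normrZ gtr0_norm ?invr_gt0// ler_pdivrMl//.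
rewrite (le_trans (ler_normB _ _))// normrZ (gtr0_norm e0).
rewrite (le_trans (lerD (QT v) (lexx _)))// -mulr2n -[_ *+ 2]mulr_natl mulrCA.
rewrite (@le_trans _ _ (e * (2 * (K * mdist (x i) xbar))))//.
  by rewrite ler_pM2l// ler_pM2l.
rewrite ler_peMl ?lerDl ?(ltW e0)// !mulr_ge0// ?(ltW e0)//; exact: mdist_ge0.
Qed.

Lemma BAP_random_projection (K : R) (x0 : x 0%N = xbar) : 0 <= K ->
  bounded_approximation_property K (free_space xbar) ->
  asymptotic_random_projection K (initial_set x) (mem_initial_set x0).
Proof.
move=> K0 BAP.
have := fun N => BAP_lipschitz_approx K N K0 BAP.
move=> /choice[m /choice[u uP]].
(* [m j <= k] makes the [j]-th approximation land in [D k]; [j <= k] bounds the candidates, so that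
   a largest one exists. *)
pose good k j := (j <= k)%N && (m j <= k)%N.
have /choice[w wP] k : exists w : X -> free_space xbar, [/\ forall z, D k (w z),
    forall y z, `|w y - w z| <= K * mdist y z &
    forall N, good k N -> forall i, (i <= N)%N ->
      `|w (x i) - delta xbar (x i)| <=
        N.+1%:R^-1 * (1 + 2 * (K * mdist (x i) xbar))].
  have [exj|noj] := pselect (exists j, good k j); last first.
    (* With no good index, in particular [k < m 0], the zero family serves and the approximation
       clause is vacuous. *)
    exists (fun=> 0); split => [z|y z|N gN]; last by case: noj; exists N.
    - exact: lspan0.
    - by rewrite subrr normr0 mulr_ge0// mdist_ge0.
  have ubj j : good k j -> (j <= k)%N by case/andP.
  case: (ex_maxnP exj ubj) => j /andP[jk mjk] jmax.
  have [uD uK uapp] := uP j.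
  exists (u j); split => // [z|N gN i iN].
    exact: span_initial_mono mjk _ (uD z).
  (* The maximal [j] is at least [N], so its estimate covers [x i] and is at least as sharp. *)
  rewrite (le_trans (uapp i (leq_trans iN (jmax _ gN))))// ler_wpM2r//.
    by rewrite addr_ge0// !mulr_ge0// mdist_ge0.
  by rewrite lef_pV2 ?posrE// ler_nat ltnS; exact: jmax.
have upsP n z : exists mu : free_space (sub_base (mem_initial_set x0 n)),
    free_embed mu = w n z.
  have [wD _ _] := wP n.
  by have [mu _ muE] := lspan_free_embed xbar _ (mem_initial_set x0 n) _ (wD z);
    exists mu.
pose ups n z := projT1 (cid (upsP n z)).
have upsE n z : free_embed (ups n z) = w n z := projT2 (cid (upsP n z)).
exists ups; split => [z [p _ [i _ <-]]|y z n]; last first.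
  by rewrite !upsE; have [_ wK _] := wP n; exact: wK.
apply/W1_cvgP/cvgrPdist_le => e e0.
set c := 1 + 2 * (K * mdist (x i) xbar).
have c0 : 0 < c by rewrite ltr_pwDl// !mulr_ge0// mdist_ge0.
have ec : 0 < e / c by rewrite divr_gt0.
have [N0 _ N0e] := near_infty_natSinv_lt (PosNum ec).
(* [N >= i] includes [x i] among the controlled points, [N >= N0] makes the error small, and
   [k >= maxn N (m N)] makes [N] good for [k]. *)
pose N := maxn i N0; exists (maxn N (m N)) => // k /= Nk.
have [_ _ wapp] := wP k; rewrite upsE distrC.
have gN : good k N by move: Nk; rewrite geq_max.
rewrite (le_trans (wapp N gN i (leq_maxl _ _)))//.
by rewrite -ler_pdivlMr// ltW// N0e//=; exact: leq_maxr.
Qed.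

Lemma random_projection_BAP (K : R) (x0 : x 0%N = xbar) : 0 <= K ->
  asymptotic_random_projection K (initial_set x) (mem_initial_set x0) ->
  bounded_approximation_property K (free_space xbar).
Proof.
move=> K0 [ups [upscvg upsK]].
pose s n := [seq delta xbar (x i) | i <- iota 0 n.+1].
have sE n : delta xbar @` initial_set x n = [set` s n].
  apply/seteqP; split => [_ [_ [i /= in_ <-] <-]|_ /mapP[i + ->]].
    by apply/mapP; exists i => //; rewrite mem_iota.
  by rewrite mem_iota => ilt; exists (x i) => //; exists i.
have upss n z : lspan [set` s n] (free_embed (ups n z)).
  by apply: closure_lspan_seq; rewrite -sE; exact: closure_free_embed.
have := fun n => lipschitz_linearization _ (s n) K _ K0 (upss n)
  (fun y z => upsK y z n).
move=> /choice[L LP].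
pose T n : {linear free_space xbar -> free_space xbar} := pairing xbar (L n).
have TK n v : `|T n v| <= K * `|v|.
  by have [_ LK _] := LP n; exact: LK.
have embcvg z : (\bigcup_n initial_set x n) z ->
    free_embed (ups n z) @[n --> \oo] --> delta xbar z.
  by move=> /upscvg/W1_cvgP.
have xbarE : (\bigcup_n initial_set x n) xbar by exists 0%N => //; exists 0%N.
have Tcvg v : T n v @[n --> \oo] --> v.
  apply: (cvg_id_closure _ _ K0 TK _ _ v (closure_span_dense _ x v x_dense)).
  apply: lspan_min; first exact: submodule_cvg_id.
  move=> _ [_ [i _ <-] <-] /=.
  have xiE : (\bigcup_n initial_set x n) (x i) by exists i => //; exists i => //=.
  (* The linearization at [x i] gives a difference of two values of the projection; the one at
     [xbar] may be nonzero but tends to [delta xbar xbar = 0]. *)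
  rewrite -[X in _ --> X]subr0 -(delta_base xbar).
  have -> : (fun n => T n (delta xbar (x i))) =
      (fun n => free_embed (ups n (x i)) - free_embed (ups n xbar)).
    by apply/funext => n; have [_ _] := LP n; exact.
  by apply: cvgB; exact: embcvg.
move=> e C e0 Ccpt.
have [N _ /(_ N (leqnn N)) TC] := cvg_id_compact _ _ K0 TK _ _ Tcvg e0 Ccpt.
exists (T N); split => //; first by exists K; exact: TK.
  apply: (submodule_finite_lspan (s N)); first exact: submodule_range.
  move=> _ [v _ <-]; have [Ls _ _] := LP N.
  apply: submodule_sum; first exact: submodule_lspan.
  by move=> p /Ls; apply: submoduleZ; exact: submodule_lspan.
by apply: opnorm_le => v v1; rewrite (le_trans (TK N v))// ler_piMr.
Qed.

End equivalence.

Theorem theorem2p19 (R : realType) (X : metricType R) (xbar : X)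
    (x : nat -> X) (x_dense : dense (range x)) (x0 : x 0%N = xbar)
    (K : R) (K_ge1 : 1 <= K) :
  bounded_approximation_property K (free_space xbar) <->
  asymptotic_random_projection K (initial_set x) (mem_initial_set x0).
Proof.
have K0 : 0 <= K by exact: le_trans K_ge1.
by split; [exact: BAP_random_projection | exact: random_projection_BAP].
Qed.
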